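(* Let $X$ be a Hausdorff space, let $\tau^c$ be the family of all closed subsets of $X$ and $\mathcal C_X$ the family of all compact subsets of $X$. Let $Y$ be a Hausdorff space with a strictly increasing closed cover $\{B_n\}_{n\in\mathbb N}$. Then $X$ is $k$-semi-stratifiable if and only if there exists a map $\phi:\tau^c\to\mathcal L(X,\mathcal F(Y))$, $F\mapsto\phi_F$, such that: (i) for each $F\in\tau^c$, $F=\bigcap_{n\in\mathbb N}\phi_F^{-1}[Y\setminus B_n]$; (ii) if $F_1,F_2\in\tau^c$ and $F_1\subset F_2$, then $\phi_{F_1}(x)\subset\phi_{F_2}(x)$ for all $x\in X$; (iii) for each $F\in\tau^c$ and $K\in\mathcal C_X$ with $F\cap K=\emptyset$, $\phi_F$ is bounded on $K$.
   Context: $\mathbb N$ is the set of positive integers. A sequence $\{B_n\}_{n\in\mathbb N}$ of closed subsets of a space $Y$ is a strictly increasing closed cover of $Y$ if $Y=\bigcup_{n}B_n$, $B_1\neq\emptyset$ and $B_n\subsetneq B_{n+1}$ for each $n$. $\mathcal F(Y)$ is the family of nonempty closed subsets of $Y$. For a set-valued map $\psi:X\to\mathcal F(Y)$ and $B\subset Y$, $\psi^{-1}[B]=\{x\in X:\psi(x)\cap B\neq\emptyset\}$ and $\psi^{\#}[B]=\{x\in X:\psi(x)\subset B\}$. $\psi$ is lower semi-continuous if $\psi^{-1}[V]$ is open in $X$ for each open $V\subset Y$; $\mathcal L(X,\mathcal F(Y))$ is the set of all lower semi-continuous maps $X\to\mathcal F(Y)$. $\psi$ is bounded on $A\subset X$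 if $A\subset\psi^{\#}[B_n]$ for some $n\in\mathbb N$. A space $X$ with topology $\tau$ is $k$-semi-stratifiable if there is a map $\rho:\mathbb N\times\tau^c\to\tau$ such that (1) $F=\bigcap_{n\in\mathbb N}\rho(n,F)$ for each $F\in\tau^c$; (2) if $F,H\in\tau^c$ and $F\subset H$, then $\rho(n,F)\subset\rho(n,H)$ for all $n\in\mathbb N$; (3) for each $K\in\mathcal C_X$ and $F\in\tau^c$ with $K\cap F=\emptyset$, there is $m\in\mathbb N$ such that $K\cap\rho(m,F)=\emptyset$. *)

(* Defs.v *)
From mathcomp Require Import all_boot boolp classical_sets topology.

Set Implicit Arguments.
Unset Strict Implicit.
Unset Printing Implicit Defensive.

Local Open Scope classical_set_scope.

(* Sequences indexed by the positive integers are represented with an index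
   shift: the term of index n : nat stands for the term number n + 1. *)

Record closedSet (X : topologicalType) := ClosedSet {
  closed_carrier :> set X;
  closed_carrierP : closed closed_carrier }.

Record openSet (X : topologicalType) := OpenSet {
  open_carrier :> set X;
  open_carrierP : open open_carrier }.

Record nonemptyClosedSet (Y : topologicalType) := NonemptyClosedSet {
  nonempty_closed_carrier :> set Y;
  nonempty_closed_carrier_nonempty : nonempty_closed_carrier !=set0;
  nonempty_closed_carrierP : closed nonempty_closed_carrier }.

Definition increasing_closed_cover (Y : topologicalType) (B : nat -> set Y) :=
  [/\ forall n, closed (B n), [set: Y] = \bigcup_n B n, B 0 !=set0
    & forall n, B n `<` B n.+1].

Definition sv_preimage (X Y : topologicalType)
    (psi : X -> nonemptyClosedSet Y) (B : set Y) : set X :=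
  [set x | psi x `&` B !=set0].

Definition sv_small_preimage (X Y : topologicalType)
    (psi : X -> nonemptyClosedSet Y) (B : set Y) : set X :=
  [set x | psi x `<=` B].

Definition sv_lower_semicontinuous (X Y : topologicalType)
    (psi : X -> nonemptyClosedSet Y) :=
  forall V : set Y, open V -> open (sv_preimage psi V).

Record lscMap (X Y : topologicalType) := LscMap {
  lsc_fun :> X -> nonemptyClosedSet Y;
  lsc_funP : sv_lower_semicontinuous lsc_fun }.

Definition sv_bounded_on (X Y : topologicalType) (B : nat -> set Y)
    (psi : X -> nonemptyClosedSet Y) (A : set X) :=
  exists n, A `<=` sv_small_preimage psi (B n).

Definition k_semi_stratifiable (X : topologicalType) :=
  exists rho : nat -> closedSet X -> openSet X,
    [/\ forall F : closedSet X, F = \bigcap_n (rho n F : set X) :> set X,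
        forall F H : closedSet X, F `<=` H -> forall n, rho n F `<=` rho n H
      & forall (K : set X) (F : closedSet X), compact K -> K `&` F = set0 ->
          exists m, K `&` rho m F = set0].

(* Main.v *)
Require Import Defs.
From mathcomp Require Import all_boot boolp classical_sets topology.

Set Implicit Arguments.
Unset Strict Implicit.
Unset Printing Implicit Defensive.

Local Open Scope classical_set_scope.

(** Both directions are explicit.

    From [phi] to [rho], let [rho n F] be the open set of the points [x] whose
    image [phi F x] leaves [B n]; the three conditions on [phi] then become
    those on [rho], boundedness on [K] in [B n] being disjointness of [K] and
    [rho n F].

    From [rho] to [phi], let [phi F x] be the intersection of the [B n] with
    [x] outside [rho n F]. It is closed, and it contains the nonempty set
    [B 0] because the cover increases. If [x] is in [F] then no [B n] occurs
    in the intersection, so [phi F x] is all of [Y] and leaves every [B n]; if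
    [x] avoids [rho n F] then [phi F x] is contained in [B n]. This gives
    (i) and (iii), and (ii) holds because a larger [F] has larger [rho n F],
    hence fewer [B n] to intersect. The only topological point is lower
    semi-continuity ([open_mem_cut]): a given [y] lies outside only finitely
    many [B n], so that [y] lies in [phi F x] is a conjunction of finitely many
    open conditions on [x], and the preimage of [V] is the union over [y] in
    [V] of the open sets so obtained. *)

Section IncreasingClosedCover.
Variables (Y : topologicalType) (B : nat -> set Y).
Hypothesis hB : increasing_closed_cover B.

Lemma cover_closed n : closed (B n).
Proof. by case: hB => + _ _ _; apply. Qed.

Lemma cover_mem y : exists n, B n y.
Proof.
case: hB => _ BT _ _; have : [set: Y] y by [].
by rewrite BT => -[n _ Bny]; exists n.
Qed.

Lemma cover_mono m n : m <= n -> B m `<=` B n.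
Proof.
move=> /subnKC <-; elim: (n - m) => [|k IH]; first by rewrite addn0.
rewrite addnS; case: hB => _ _ _ Bproper.
by apply: subset_trans IH _; case: (Bproper (m + k)).
Qed.

Lemma cover_escape n : (~` B n) !=set0.
Proof.
case: hB => _ _ _ /(_ n) [_ BnS]; apply: contrapT => Cn0; apply: BnS => y _.
by apply: contrapT => nBy; apply: Cn0; exists y.
Qed.

Definition cut (X : Type) (U : nat -> set X) (x : X) : set Y :=
  \bigcap_(n in [set n | ~ U n x]) B n.

Lemma cut_nonempty (X : Type) (U : nat -> set X) x : cut U x !=set0.
Proof.
by case: hB => _ _ [y B0y] _; exists y => n _; apply: cover_mono B0y.
Qed.

Lemma cut_closed (X : Type) (U : nat -> set X) x : closed (cut U x).
Proof. by apply: closed_bigI => n _; apply: cover_closed. Qed.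

Definition cut_map (X : Type) (U : nat -> set X) (x : X) :
    nonemptyClosedSet Y :=
  NonemptyClosedSet (cut_nonempty U x) (@cut_closed X U x).

(** Membership of [y] in [B N] settles the conditions of all indices from [N]
    on, so only those below [N] restrict [x]. *)
Lemma open_mem_cut (X : topologicalType) (U : nat -> set X) y :
  (forall n, open (U n)) -> open [set x | cut U x y].
Proof.
move=> Uopen; have [N BNy] := cover_mem y.
have -> : [set x | cut U x y] = \bigcap_(n < N) [set x | ~ U n x -> B n y].
  apply/seteqP; split=> x /= Hx n; first by move=> _; apply: Hx.
  by case: (ltnP n N) => [|/cover_mono/(_ _ BNy)//]; apply: Hx.
rewrite bigcap_mkord; apply: big_ind => [||k _]; [exact: openT|exact: openI|].
have [Bky|nBky] := pselect (B k y).
  have -> : [set x | ~ U k x -> B k y] = setT by apply/seteqP; split=> x /=.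
  exact: openT.
have -> : [set x | ~ U k x -> B k y] = U k.
  apply/seteqP; split=> x /=; last by move=> Ux /(_ Ux).
  by move=> Hx; apply: contrapT => /Hx.
exact: Uopen.
Qed.

Lemma cut_lower_semicontinuous (X : topologicalType) (U : nat -> set X) :
  (forall n, open (U n)) -> sv_lower_semicontinuous (cut_map U).
Proof.
move=> Uopen V _.
have -> : sv_preimage (cut_map U) V = \bigcup_(y in V) [set x | cut U x y].
  apply/seteqP; split=> x; first by case=> y [cy Vy]; exists y.
  by case=> y Vy cy; exists y.
by apply: bigcup_open => y _; apply: open_mem_cut.
Qed.

Lemma cut_preimage (X : topologicalType) (U : nat -> set X) :
  \bigcap_n sv_preimage (cut_map U) (~` B n) = \bigcap_n U n.
Proof.
apply/seteqP; split=> x Hx n _.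
  apply: contrapT => nUx; have [y [cy nBy]] := Hx n I.
  exact/nBy/cy.
have [y nBy] := cover_escape n; exists y; split=> // m nUx.
by case: nUx; apply: Hx.
Qed.

End IncreasingClosedCover.

Theorem theorem3p2 (X Y : topologicalType) (B : nat -> set Y)
    (hX : hausdorff_space X) (hY : hausdorff_space Y)
    (hB : increasing_closed_cover B) :
  k_semi_stratifiable X <->
  exists phi : closedSet X -> lscMap X Y,
    [/\ forall F : closedSet X,
          F = \bigcap_n sv_preimage (phi F) (~` B n) :> set X,
        forall F1 F2 : closedSet X, F1 `<=` F2 ->
          forall x : X, phi F1 x `<=` phi F2 x
      & forall (F : closedSet X) (K : set X), compact K -> F `&` K = set0 ->
          sv_bounded_on B (phi F) K].
Proof.
split=> [[rho [rhoI rho_mono rho_compact]]|[phi [phiI phi_mono phi_compact]]].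
  pose U F n : set X := rho n F.
  have Uopen F n : open (U F n) by exact: open_carrierP.
  exists (fun F => LscMap (cut_lower_semicontinuous hB (Uopen F))).
  split=> [F|F1 F2 F12 x y /= cy n nU2|F K cK FK0].
  - by rewrite cut_preimage; apply: rhoI.
  - by apply: cy => U1; apply: nU2; apply: rho_mono U1.
  - have [|m Km0] := rho_compact K F cK; first by rewrite setIC.
    exists m => x Kx y; apply=> Ux.
    by have : (K `&` rho m F) x by []; rewrite Km0.
have phi_open n F : open (sv_preimage (phi F) (~` B n)).
  by apply: lsc_funP; apply: closed_openC; apply: cover_closed.
exists (fun n F => OpenSet (phi_open n F)).
split=> [F|F H FH n x /= [y [phiy nBy]]|K F cK KF0].
- exact: phiI.
- by exists y; split=> //; apply: phi_mono phiy.
- have [|m Km] := phi_compact F K cK; first by rewrite setIC.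
  exists m; rewrite -subset0 => x [Kx [y [phiy nBy]]].
  exact/nBy/(Km x Kx).
Qed.
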